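(* Let $G$ be an infinite, locally finite, connected graph with infinite motion, let $v_0\in V(G)$ and let $\varepsilon>0$. If there exist infinitely many $n\in\mathbb{N}$ such that $$|S_{v_0}(n)|\le \frac{n}{(1+\varepsilon)\log_2 n},$$ then the distinguishing number $D(G)$ is either $1$ or $2$.
   Context: $S_{v_0}(n)$ is the set of vertices at distance exactly $n$ from $v_0$. $G$ has infinite motion if every nontrivial automorphism of $G$ moves infinitely many vertices. The distinguishing number $D(G)$ is the least cardinal $d$ such that there is a labeling $V(G)\to X$ with $|X|=d$ preserved by no nontrivial automorphism of $G$. *)

(* Defs.v *)
From HB Require Import structures.
From mathcomp Require Import all_boot all_order all_algebra finmap.
From mathcomp Require Import boolp classical_sets functions cardinality reals exp.
Set Implicit Arguments.
Unset Strict Implicit.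
Unset Printing Implicit Defensive.
Import Order.TTheory GRing.Theory Num.Theory.
Local Open Scope classical_set_scope.
Local Open Scope ring_scope.

Record sgraph := SGraph {
  vertex :> Type ;
  adj : vertex -> vertex -> Prop ;
  adj_sym : forall x y, adj x y -> adj y x ;
  adj_irrefl : forall x, ~ adj x x }.

Section Graph.
Variable G : sgraph.

Fixpoint walk (n : nat) (x y : G) : Prop :=
  if n is m.+1 then exists2 z, adj x z & walk m z y else x = y.

Definition connected_graph : Prop := forall x y : G, exists n, walk n x y.

Definition locally_finite : Prop := forall x : G, finite_set [set y | adj x y].

Definition infinite_graph : Prop := infinite_set [set: G].

(* The relation form avoids a junk value when x and y are not connected. *)
Definition at_distance (x y : G) (n : nat) : Prop :=
  walk n x y /\ forall m, walk m x y -> (n <= m)%N.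

Definition sphere (v0 : G) (n : nat) : set G := [set v | at_distance v0 v n].

Definition automorphism (f : G -> G) : Prop :=
  bijective f /\ forall x y, adj (f x) (f y) <-> adj x y.

Definition nontrivial (f : G -> G) : Prop := exists x, f x <> x.

Definition infinite_motion : Prop :=
  forall f, automorphism f -> nontrivial f -> infinite_set [set x | f x <> x].

Definition preserves (f : G -> G) (X : Type) (c : G -> X) : Prop :=
  forall x, c (f x) = c x.

Definition distinguishing (X : Type) (c : G -> X) : Prop :=
  forall f, automorphism f -> nontrivial f -> ~ preserves f c.

(* D(G) = |X|: cardinals are represented by types and compared by the existence
   of an injection; labelings need not be surjective. *)
Definition distinguishing_number_is (X : Type) : Prop :=
  (exists c : G -> X, distinguishing c) /\
  forall (Y : Type) (c : G -> Y), distinguishing c -> ([set: X] #<= [set: Y])%card.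

End Graph.

(* Number of elements of a finite set; 0 by convention if A is infinite. *)
Definition set_size (T : Type) (A : set T) : nat :=
  #|` fset_set (A : set {classic T})|.

Definition log2 (R : realType) (x : R) : R := ln x / ln 2.

(* Main.v *)
(* Call [lev x] the distance from [v0].  Given [m], colour the levels in [(m, 2m]]
   with [false] and level [2m+1] with [true]: a colour-preserving automorphism [f]
   with [lev (f v0) <= m] and [lev (f^-1 v0) <= m] then maps the ball of radius [2m]
   to itself, hence preserves every level above [2m].  If [f] moves a vertex of the
   ball of radius [m], infinite motion forces it to move a vertex on each such level;
   likewise its action on a ball of radius [n > 2m] is determined by its action on
   level [n].  So if level [n] has [s] vertices there are at most [s ^ s] actions to
   break, and each of the [n - 2m - 1] free levels can be coloured so as to break at
   least half of the remaining ones.  Sparse spheres give [s ^ s < 2 ^ (n - 2m - 1)]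
   for suitable [n].  Every nontrivial automorphism is caught for large [m], so
   iterating with [m := n] yields a distinguishing 2-colouring. *)
Require Import Defs.
From HB Require Import structures.
From mathcomp Require Import all_boot all_order all_algebra finmap.
From mathcomp Require Import boolp classical_sets functions cardinality reals exp.
From mathcomp Require Import zify lra.
Set Implicit Arguments.
Unset Strict Implicit.
Unset Printing Implicit Defensive.
Import Order.TTheory GRing.Theory Num.Theory.
Local Open Scope ring_scope.

(** * Two-colourings that break finite families of maps *)

(** Double counting over all colourings. If [act i] moves [x], flipping the colour of [x] sends
    colourings kept by [i] to colourings not kept, so each [i] keeps at most half of them, and some
    colouring does at least as well as the average. *)
Lemma halving_coloring (X I : finType) (A : {set I}) (act : I -> X -> X) :
  (forall i, i \in A -> exists x, act i x != x) ->
  exists c : X -> bool,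
    (#|[set i in A | [forall x, c (act i x) == c x]]|.*2 <= #|A|)%N.
Proof.
move=> moves; pose keeps (c : {ffun X -> bool}) i := [forall x, c (act i x) == c x].
have half i : i \in A -> (#|[set c | keeps c i]|.*2 <= #|{ffun X -> bool}|)%N.
  move=> /moves[x fx]; pose flip (c : {ffun X -> bool}) := [ffun y => c y (+) (y == x)].
  have flipK : involutive flip.
    by move=> c; apply/ffunP => y; rewrite !ffunE -addbA addbb addbF.
  have := cardsUI [set c | keeps c i] (flip @: [set c | keeps c i]).
  rewrite (card_imset _ (inv_inj flipK)) addnn => <-.
  rewrite [X in (_ + X)%N](_ : _ = 0%N) ?addn0 ?max_card //.
  apply/eqP; rewrite cards_eq0; apply/eqP/setP => c; rewrite !inE.
  apply/negP => /andP[/forallP/(_ x)/eqP cx /imsetP[e]]; rewrite inE.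
  move=> /forallP/(_ x)/eqP ex ce; move: cx.
  by rewrite ce !ffunE (negbTE fx) eqxx ex; case: (e x).
apply: contrapT => none.
have more (c : {ffun X -> bool}) :
    (#|A| < #|[set i in A | keeps c i]|.*2)%N.
  by rewrite ltnNge; apply/negP => le; apply: none; exists c.
have count : (\sum_(c : {ffun X -> bool}) #|[set i in A | keeps c i]| =
    \sum_(i in A) #|[set c | keeps c i]|)%N.
  transitivity (\sum_(c : {ffun X -> bool}) \sum_(i in [set i in A | keeps c i]) 1)%N.
    by apply: eq_bigr => c _; rewrite sum1_card.
  transitivity (\sum_(i in A) \sum_(c in [set c | keeps c i]) 1)%N; last first.
    by apply: eq_bigr => i _; rewrite sum1_card.
  rewrite (exchange_big_dep (fun i => i \in A)) /=; last first.
    by move=> c i _; rewrite inE => /andP[].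
  by apply: eq_bigr => i iA; apply: eq_bigl => c; rewrite !inE iA.
have : (\sum_(c : {ffun X -> bool}) #|A|.+1 <=
    \sum_(i in A) #|{ffun X -> bool}|)%N.
  apply: (@leq_trans (\sum_(c : {ffun X -> bool}) #|[set i in A | keeps c i]|.*2)%N).
    exact: leq_sum.
  rewrite (eq_bigr _ (fun c _ => esym (muln2 _))) -big_distrl /= count.
  by rewrite big_distrl /=; apply: leq_sum => i iA; rewrite muln2 half.
rewrite !sum_nat_const mulnC leq_pmul2r ?ltnn //.
by apply/card_gt0P; exists [ffun=> false].
Qed.

(** Induction on the number of levels: level [a] is spent on halving [A], and the survivors, fewer
    than half of the allowance, are left to the levels above. *)
Lemma levelwise_breaking_coloring (T : choiceType) (lev : T -> nat)
    (S : nat -> {fset T}) (I : finType) (phi : I -> T -> T) k a (A : {set I}) :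
  (forall j x, (x \in S j) = (lev x == j)) -> (#|A| < 2 ^ k)%N ->
  (forall i j, i \in A -> (a <= j < a + k)%N ->
     (forall x, lev x = j -> lev (phi i x) = j) /\
     exists2 x, lev x = j & phi i x <> x) ->
  exists c : T -> bool, forall i, i \in A ->
    exists2 x, (a <= lev x < a + k)%N & c (phi i x) <> c x.
Proof.
move=> HS; elim: k a A => [|k IH] a A cardA HA.
  exists (fun=> true) => i iA; move: cardA; rewrite expn0 ltnS leqn0 cards_eq0.
  by move=> /eqP A0; rewrite A0 inE in iA.
have Hact i : i \in A -> forall x : S a, phi i (val x) \in S a.
  move=> iA x; have [stay _] := HA i a iA ltac:(lia).
  by rewrite HS; apply/eqP/stay/eqP; rewrite -HS; exact: valP.
pose act i (x : S a) : S a := insubd x (phi i (val x)).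
have actE i x : i \in A -> val (act i x) = phi i (val x).
  by move=> iA; rewrite val_insubd Hact.
have [|c0 Hc0] := @halving_coloring (S a) I A act.
  move=> i iA; have [_ [x lx fx]] := HA i a iA ltac:(lia).
  have xS : x \in S a by rewrite HS lx.
  by exists [` xS]%fset; apply/eqP => /(congr1 val); rewrite actE.
set A' := [set i in A | _] in Hc0.
have [|i j iA' ja|c1 Hc1] := IH a.+1 A'.
- by move: cardA; rewrite expnS; lia.
- by apply: HA; [move: iA'; rewrite inE => /andP[] | lia].
(* The two colourings do not interfere: every [phi i] preserves the levels, so a survivor is broken
   by [c1] at a vertex and an image that both lie off level [a]. *)
exists (fun x => if insub x is Some u then c0 (u : S a) else c1 x) => i iA.
have [iA'|iA'] := boolP (i \in A').
  have [x lx cx] := Hc1 i iA'; exists x; first lia.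
  have [stay _] := HA i (lev x) iA ltac:(lia).
  rewrite !insubN //; rewrite HS; last by have := stay x erefl; lia.
  by lia.
move: iA'; rewrite inE iA /= negb_forall => /existsP[x cx].
exists (val x).
  by have := valP x; rewrite HS => /eqP ->; lia.
by rewrite valK -actE // valK; apply/eqP.
Qed.

Local Open Scope classical_set_scope.

(** * Levels around the root *)

Section Levels.
Variables (G : sgraph) (v0 : G).

Lemma walk_rcons n (x y z : G) : walk n x y -> adj y z -> walk n.+1 x z.
Proof.
elim: n x => [|n IH] x /=; first by move=> -> yz; exists z.
by move=> [u xu uy] yz; exists u => //; apply: IH.
Qed.

Lemma walk_sym n (x y : G) : walk n x y -> walk n y x.
Proof.
elim: n x => [|n IH] x /=; first by move=> ->.
move=> [u xu uy]; apply: (@walk_rcons n _ u); first exact: IH.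
exact: adj_sym.
Qed.

(** The facts about the distance from [v0] used below; [lev_down] gives a neighbour one step closer,
    so induction on the level follows a geodesic. *)
Record level_function (lev : G -> nat) : Prop := LevelFunction {
  lev_sphere : forall x n, sphere v0 n x <-> lev x = n ;
  lev_root : forall x, lev x = 0%N <-> x = v0 ;
  lev_adj : forall x y, adj x y -> (lev y <= (lev x).+1)%N ;
  lev_down : forall x n, lev x = n.+1 -> exists2 y, adj y x & lev y = n }.

Lemma level_function_exists : connected_graph G -> exists lev, level_function lev.
Proof.
move=> conn.
have dist x : exists n, at_distance v0 x n.
  have wx : exists n, `[< walk n v0 x >].
    by have [n w] := conn v0 x; exists n; apply/asboolP.
  exists (ex_minn wx); case: ex_minnP => n /asboolP w min; split=> // m wm.
  by apply: min; apply/asboolP.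
have [lev Hlev] := choice dist; exists lev.
have sph x n : sphere v0 n x <-> lev x = n.
  split; last by move=> <-; exact: Hlev.
  move=> [w min]; have [w' min'] := Hlev x.
  by apply/eqP; rewrite eqn_leq min // min'.
split=> // [x|x y xy|x n lx].
- split=> [l0|->]; first by have [] := Hlev x; rewrite l0 => /esym.
  by apply/eqP; rewrite -leqn0; have [_] := Hlev v0; apply.
- have [w _] := Hlev x; have [_] := Hlev y; apply.
  exact: walk_rcons xy.
have [w min] := Hlev x; rewrite lx in w min.
have /= [y xy yw] := walk_sym w; exists y; first exact: adj_sym.
have lyn : (lev y <= n)%N by have [_] := Hlev y; apply; exact: walk_sym.
have [wy _] := Hlev y; have := min _ (walk_rcons wy (adj_sym xy)).
by rewrite ltnS => nly; apply/eqP; rewrite eqn_leq lyn.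
Qed.

Variables (lev : G -> nat).
Hypothesis levP : level_function lev.

Lemma finite_level n : locally_finite G -> finite_set [set x | lev x = n].
Proof.
move=> lf; elim: n => [|n IH].
  apply: (@sub_finite_set _ _ [set v0]) => // x /= /(lev_root levP); exact.
apply: (@sub_finite_set _ _ (\bigcup_(y in [set x | lev x = n]) [set z | adj y z])).
  by move=> x /= /(lev_down levP)[y yx ly]; exists y.
exact: bigcup_finite.
Qed.

Lemma finite_ball n : locally_finite G -> finite_set [set x | (lev x <= n)%N].
Proof.
move=> lf; apply: (@sub_finite_set _ _ (\bigcup_(k in `I_n.+1) [set x | lev x = k])).
  by move=> x /= lx; exists (lev x).
apply: bigcup_finite => // k _; exact: finite_level.
Qed.

(** * Automorphisms acting on balls and levels *)

(** Every ball of radius at least [r] is mapped into itself. Required of a map and its inverse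
    together, this preserves each level above [r]. *)
Definition stable_from (r : nat) (f : G -> G) :=
  forall x, (lev (f x) <= maxn (lev x) r)%N.

Lemma automorphism_inv (f g : G -> G) :
  cancel f g -> cancel g f -> automorphism f -> automorphism g.
Proof.
move=> fK gK [_ fadj]; split; first by exists f.
by move=> x y; rewrite -fadj !gK.
Qed.

Lemma automorphism_comp (f g : G -> G) :
  automorphism f -> automorphism g -> automorphism (g \o f).
Proof.
move=> [fbij fadj] [gbij gadj]; split; first exact: bij_comp.
by move=> x y /=; rewrite gadj fadj.
Qed.

(** Crossing an edge raises the level by at most one, so outside the ball the bound passes from a
    vertex to its neighbours one level further out. *)
Lemma stable_from_ball r (f : G -> G) : automorphism f ->
  (forall x, (lev x <= r)%N -> (lev (f x) <= r)%N) -> stable_from r f.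
Proof.
move=> [_ fadj] ball x; have [n lx] : exists n, lev x = n by exists (lev x).
elim: n x lx => [|n IH] x lx; first by rewrite lx max0n ball ?lx.
have [xr|xr] := leqP (lev x) r; first by have := ball x xr; lia.
have [y yx ly] := lev_down levP lx; have := IH y ly.
by have /fadj/(lev_adj levP) := yx; lia.
Qed.

Lemma lev_automorphism_bound m (f : G -> G) x : automorphism f ->
  (lev (f v0) <= m)%N -> (lev (f x) <= lev x + m)%N.
Proof.
move=> [_ fadj] fv; have [n lx] : exists n, lev x = n by exists (lev x).
elim: n x lx => [|n IH] x lx.
  by move/(lev_root levP) : lx => ->; lia.
have [y yx ly] := lev_down levP lx; have := IH y ly.
by have /fadj/(lev_adj levP) := yx; lia.
Qed.

(* Along a geodesic from [v0], the image under [f] would have to leave the ball of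
   radius [2m] through a vertex of colour [true] whose preimage has colour [false]. *)
Lemma marked_ball_stable m (f : G -> G) (c : G -> bool) :
  automorphism f -> preserves f c -> (lev (f v0) <= m)%N ->
  (forall x, (m < lev x <= m.*2)%N -> c x = false) ->
  (forall x, lev x = m.*2.+1 -> c x = true) ->
  stable_from m.*2 f.
Proof.
move=> faut fc fv cF cT; apply: stable_from_ball => // x.
have [n lx] : exists n, lev x = n by exists (lev x).
elim: n x lx => [|n IH] x lx xr.
  by move/(lev_root levP) : lx => ->; lia.
have [y yx ly] := lev_down levP lx.
have := IH y ly ltac:(lia); have bound := lev_automorphism_bound x faut fv.
case: faut => _ fadj; have /fadj/(lev_adj levP) := yx => fxy fy.
(* Here [f x] lies exactly on level [2m+1], and [bound] then forces [lev x > m]. *)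
rewrite leqNgt; apply/negP => fx.
have := fc x; rewrite cT ?cF //; first by lia.
by lia.
Qed.

Lemma stable_level r (f g : G -> G) x : cancel f g ->
  stable_from r f -> stable_from r g -> (r < lev x)%N -> lev (f x) = lev x.
Proof. by move=> fK fr gr xr; have := fr x; have := gr (f x); rewrite fK; lia. Qed.

(* Otherwise [f] on the ball, extended by the identity, would be an automorphism
   of finite motion. *)
Lemma fixed_level_fixes_ball r j (f g : G -> G) :
  locally_finite G -> infinite_motion G ->
  automorphism f -> cancel f g -> cancel g f ->
  stable_from r f -> stable_from r g -> (r < j)%N ->
  (forall x, lev x = j -> f x = x) -> forall x, (lev x <= j)%N -> f x = x.
Proof.
move=> lf motion faut fK gK fr gr rj fix_j x0 x0j; apply: contrapT => fx0.
pose h (u : G -> G) x := if (lev x <= j)%N then u x else x.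
have hK u v : cancel u v -> stable_from r u -> cancel (h u) (h v).
  move=> uK ur x; rewrite /h; have [xj|xj] := leqP (lev x) j.
    by rewrite uK ifT //; have := ur x; lia.
  by rewrite leqNgt xj.
(* An edge leaving the ball starts on level [j], where [f] is the identity; if [f x] is that
   endpoint, injectivity of [f] gives [f x = x]. *)
have cross x y : (lev x <= j)%N -> (j < lev y)%N -> adj (f x) y <-> adj x y.
  move=> xj yj; suff : adj (f x) y \/ adj x y -> f x = x.
    by move=> H; split=> a; have := a; rewrite H //; [left | right].
  case=> /(lev_adj levP) ly; last by apply: fix_j; lia.
  apply: (can_inj fK); apply: fix_j; have := fr x; lia.
have adj_symE (x y : G) : adj x y <-> adj y x by split; exact: adj_sym.
have haut : automorphism (h f).
  split; first by exists (h g); apply: hK.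
  move=> x y; rewrite /h.
  have [xj|xj] := leqP (lev x) j; have [yj|yj] := leqP (lev y) j => //.
  - by case: faut.
  - exact: cross.
  - by rewrite adj_symE cross // adj_symE.
apply: (motion (h f) haut); first by exists x0; rewrite /h x0j.
apply: sub_finite_set (finite_ball j lf) => x /=; rewrite /h.
by case: ifP.
Qed.

(** * Colouring one annulus *)

(** One round of the construction. Only the colours on levels in [(m, n]] are prescribed, so rounds
    on disjoint annuli can be combined. *)
Lemma breaking_annulus m n :
  locally_finite G -> infinite_motion G -> (m.*2.+1 <= n)%N ->
  (set_size (sphere v0 n) ^ set_size (sphere v0 n) < 2 ^ (n - m.*2.+1))%N ->
  exists col : G -> bool, forall c : G -> bool,
    (forall x, (m < lev x <= n)%N -> c x = col x) ->
    forall f g : G -> G, automorphism f -> cancel f g -> cancel g f ->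
      (lev (f v0) <= m)%N -> (lev (g v0) <= m)%N ->
      (exists2 x, (lev x <= m)%N & f x <> x) -> ~ preserves f c.
Proof.
move=> lf motion mn small.
pose S (j : nat) : {fset {classic G}} := fset_set (sphere v0 j : set {classic G}).
have HS j (x : {classic G}) : (x \in S j) = (lev x == j).
  have sphE : sphere v0 j = [set x | lev x = j].
    by apply/seteqP; split=> y /(lev_sphere levP).
  rewrite /S in_fset_set; last by rewrite sphE; exact: finite_level.
  apply/idP/eqP => [|lx]; first by rewrite inE => /(lev_sphere levP).
  by rewrite inE; apply/(lev_sphere levP).
pose good (f g : G -> G) := [/\ automorphism f, cancel f g, cancel g f,
  stable_from m.*2 f & stable_from m.*2 g] /\
  exists2 x, (lev x <= m)%N & f x <> x.
pose restricts (f : G -> G) (h : {ffun S n -> S n}) :=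
  forall x : S n, f (val x) = val (h x).
(* Automorphisms with the same action on level [n] agree on the whole ball of
   radius [n], so it suffices to break one representative of each action. *)
have /choice[rep Hrep] (h : {ffun S n -> S n}) : exists u : G -> G,
    (exists f g, good f g /\ restricts f h) ->
    (exists g, good u g) /\ restricts u h.
  have [[f [g [fg fh]]]|none] := pselect (exists f g, good f g /\ restricts f h).
    by exists f => _; split=> //; exists g.
  by exists id => /none.
have level f g x : good f g -> (m.*2 < lev x)%N -> lev (f x) = lev x.
  by case=> -[_ fK _ fr gr] _ xr; exact: stable_level fK fr gr xr.
pose A := [set h | `[< exists f g, good f g /\ restricts f h >]]%SET.
(* The free levels are [2m+2] up to [n], since [2m+1] carries the marker. *)
have [||c1 Hc1] := @levelwise_breaking_coloring {classic G} lev S _ rep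
    (n - m.*2.+1) m.*2.+2 A HS.
- apply: leq_ltn_trans (max_card _) _; rewrite card_ffun.
  by rewrite -cardfE.
- move=> h j; rewrite inE => /asboolP/Hrep[[g hg] _] jn.
  split; first by move=> x lx; rewrite (level _ _ _ hg) // lx; lia.
  (* Fixing level [j] pointwise would fix the ball of radius [m] too, where a vertex is moved. *)
  apply: contrapT => fixj; case: hg => -[haut hK gK hr gr] [x xm]; apply.
  apply: (@fixed_level_fixes_ball m.*2 j _ g) => //; try lia.
  by move=> y ly; apply: contrapT => hy; apply: fixj; exists y.
pose col x := if (lev x <= m.*2)%N then false
  else if lev x == m.*2.+1 then true else c1 x.
exists col => c cE f g faut fK gK fv gv moved fc.
have cF x : (m < lev x <= m.*2)%N -> c x = false.
  by move=> lx; rewrite cE /col; [rewrite ifT //; lia | lia].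
have cT x : lev x = m.*2.+1 -> c x = true.
  by move=> lx; rewrite cE /col lx; [rewrite ltnn eqxx | lia].
have gaut := automorphism_inv fK gK faut.
have gc : preserves g c by move=> x; rewrite -{2}(gK x) fc.
have fr := marked_ball_stable faut fc fv cF cT.
have gr := marked_ball_stable gaut gc gv cF cT.
have fg : good f g by [].
have fS (x : S n) : f (val x) \in S n.
  by have := valP x; rewrite !HS => /eqP lx; rewrite (level _ _ _ fg) ?lx //; lia.
pose h0 (x : S n) : S n := insubd x (f (val x)).
pose h : {ffun S n -> S n} := [ffun x => h0 x].
have fh : restricts f h by move=> x; rewrite ffunE val_insubd fS.
have hP : exists f g, good f g /\ restricts f h by exists f, g.
have [[g' hg'] hh] := Hrep h hP.
have agree x : (lev x <= n)%N -> rep h x = f x.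
  case: (hg') => -[haut hK g'K hr g'r] _ xn.
  apply: (can_inj gK); rewrite fK.
  apply: (@fixed_level_fixes_ball m.*2 n (g \o rep h) (g' \o f)) => //.
  - exact: automorphism_comp.
  - by move=> y /=; rewrite gK hK.
  - by move=> y /=; rewrite g'K fK.
  - by move=> y /=; have := gr (rep h y); have := hr y; lia.
  - by move=> y /=; have := g'r (f y); have := fr y; lia.
  - move=> y ly /=; have yS : (y : {classic G}) \in S n by rewrite HS ly.
    by have := hh [` yS]%fset; rewrite -fh /= => ->; rewrite fK.
have hA : h \in A by rewrite inE; apply/asboolP.
have [x lx] := Hc1 h hA; rewrite agree; last by lia.
have lfx : lev (f x) = lev x by apply: (level _ _ _ fg); lia.
have := fc x; rewrite !cE /col ?lfx; try lia.
by rewrite !ifF //; lia.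
Qed.

End Levels.

(** * Gluing the annuli and the growth estimate *)

Lemma glue_annuli (T : Type) (lev : T -> nat) (N : nat -> nat)
    (col : nat -> T -> bool) : (forall m, (m < N m)%N) ->
  exists c : T -> bool, forall k x,
    (iter k N 0 < lev x <= iter k.+1 N 0)%N -> c x = col (iter k N 0%N) x.
Proof.
move=> N_gt; have ge k : (k <= iter k N 0)%N.
  by elim: k => //= k IH; have := N_gt (iter k N 0%N); lia.
have mono : {homo (fun k => iter k N 0%N) : i j / (i <= j)%N}.
  by apply: homo_leq => // [|k]; [exact: leq_trans | exact: ltnW].
have ex x : exists k, (lev x <= iter k N 0)%N by exists (lev x).
(* The least [k] with [lev x] at most the [k]-th iterate marks the outer end of the annulus of [x];
   its predecessor marks the inner end. *)
exists (fun x => col (iter (ex_minn (ex x)).-1 N 0%N) x) => k x /andP[kx xk].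
case: ex_minnP => j xj /(_ _ xk) jk; suff -> : j = k.+1 by [].
apply/eqP; rewrite eqn_leq jk ltnNge; apply/negP => /mono; lia.
Qed.

(** In base-2 logarithms, [s log s <= s log n <= n / (1 + eps) < n - m]; the last inequality amounts
    to [n > b]. *)
Lemma sparse_exponent (R : realType) (eps : R) m : 0 < eps ->
  exists N, forall n s, (N <= n)%N ->
    s%:R <= n%:R / ((1 + eps) * log2 (n%:R : R)) -> (s ^ s < 2 ^ (n - m))%N.
Proof.
move=> e0; pose b := m%:R * (1 + eps) / eps : R.
have b0 : 0 <= b by rewrite !mulr_ge0 ?invr_ge0 ?ler0n //; lra.
have := Num.Theory.archi_boundP b0; set B := Num.Def.archi_bound b => bB.
exists (maxn B (maxn 2 m.+1)) => n s; rewrite !geq_max => /and3P[Bn n2 mn] sn.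
have ln2 : 0 < ln (2 : R) by apply: ln_gt0; lra.
have n2R : (2 : R) <= n%:R by rewrite ler_nat.
have lnn : ln (2 : R) <= ln n%:R by rewrite ler_ln ?posrE //; lra.
have gap : n%:R < (n - m)%:R * (1 + eps).
  have : b < n%:R by apply: lt_le_trans bB _; rewrite ler_nat.
  rewrite /b ltr_pdivrMr // natrB; last exact: ltnW.
  nra.
have key : s%:R * ln n%:R * (1 + eps) <= n%:R * ln (2 : R).
  move: sn; rewrite /log2 ler_pdivlMr; last by rewrite mulr_gt0 ?divr_gt0 //; lra.
  by rewrite !mulrA ler_pdivrMr // [_ * _ * ln n%:R]mulrAC.
(* [s = 0] is separate: [0 ^ 0] is [1], and [n > m] suffices. *)
case: s sn key => [|s] sn key; first by rewrite expn0 -{1}(expn0 2) ltn_exp2l //; lia.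
have s1 : 1 <= s.+1%:R :> R by rewrite ler1n.
have lnn0 : 0 < ln n%:R :> R by lra.
(* Needed to replace [log s] by [log n]; it follows from [key] because [ln 2 <= ln n]. *)
have sleqn : s.+1%:R <= n%:R :> R.
  rewrite -(ler_pM2r lnn0); have : 0 <= s.+1%:R * ln n%:R * eps :> R.
    by rewrite !mulr_ge0 ?ler0n //; lra.
  have : n%:R * ln 2 <= n%:R * ln n%:R :> R by rewrite ler_wpM2l ?ler0n.
  lra.
have lns : ln s.+1%:R <= ln n%:R :> R by rewrite ler_ln ?posrE //; lra.
have sln : s.+1%:R * ln s.+1%:R <= s.+1%:R * ln n%:R :> R by rewrite ler_wpM2l //; lra.
rewrite -(ltr_nat R) !natrX -ltr_ln ?posrE ?exprn_gt0 //; try lra.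
rewrite !lnXn //; try lra.
rewrite -[ltLHS]mulr_natl -[ltRHS]mulr_natl.
rewrite -(@ltr_pM2r _ (1 + eps)); last lra.
apply: (@le_lt_trans _ _ (n%:R * ln 2)).
  by apply: le_trans key; rewrite ler_wpM2r //; lra.
by rewrite mulrAC ltr_pM2r.
Qed.

(** * From a distinguishing 2-colouring to the distinguishing number *)

Lemma card_le_setT (X Y : Type) (f : X -> Y) :
  injective f -> ([set: X] #<= [set: Y])%card.
Proof.
move=> fI; rewrite -(card_le_eql (inj_card_eq (in2W fI))).
exact: subset_card_le.
Qed.

(** Without nontrivial automorphisms a constant labeling suffices. Otherwise any distinguishing
    labeling separates some [x] from [f x], hence uses two labels. *)
Lemma distinguishing_number_le2 (G : sgraph) (v0 : G) (c : G -> bool) :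
  distinguishing c ->
  distinguishing_number_is G 'I_1 \/ distinguishing_number_is G 'I_2.
Proof.
move=> cD.
have [[f [faut fnt]]|rigid] :=
  pselect (exists f : G -> G, automorphism f /\ nontrivial f).
  right; split.
    exists (fun x => if c x then ord0 else ord_max : 'I_2) => h haut hnt hc.
    by apply: (cD h haut hnt) => x; have := hc x; case: (c _); case: (c _).
  move=> Y d dD; have [x dx] : exists x, d (f x) <> d x.
    apply: contrapT => none; apply: (dD f faut fnt) => x.
    by apply: contrapT => ?; apply: none; exists x.
  apply: (@card_le_setT _ _ (fun i : 'I_2 => if i == ord0 then d (f x) else d x)).
  move=> i j; case: (eqVneq i ord0) => [->|i0]; case: (eqVneq j ord0) => [->|j0] //.
  - by move=> /esym.
  - by move=> _; apply: val_inj; case: i i0 => -[|[|]] //; case: j j0 => -[|[|]].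
left; split.
  by exists (fun=> ord0) => f faut fnt; case: rigid; exists f.
move=> Y d _; apply: (@card_le_setT _ _ (fun=> d v0)) => i j _.
by rewrite !ord1.
Qed.

Theorem theorem8 (R : realType) (G : sgraph) (v0 : G) (eps : R)
  (G_infinite : infinite_graph G)
  (G_locally_finite : locally_finite G)
  (G_connected : connected_graph G)
  (G_motion : infinite_motion G)
  (eps_gt0 : 0 < eps)
  (small_spheres : infinite_set [set n : nat |
     (set_size (sphere v0 n))%:R <= n%:R / ((1 + eps) * log2 (n%:R : R))]) :
  distinguishing_number_is G 'I_1 \/ distinguishing_number_is G 'I_2.
Proof.
have [lev levP] := level_function_exists v0 G_connected.
have large b : exists2 n, (b <= n)%N &
    (set_size (sphere v0 n))%:R <= n%:R / ((1 + eps) * log2 (n%:R : R)).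
  apply: contrapT => none; apply: small_spheres.
  apply: (@sub_finite_set _ _ `I_b); last exact: finite_II.
  by move=> n sn /=; rewrite ltnNge; apply/negP => bn; apply: none; exists n.
pose breaks m n (col : G -> bool) := forall c : G -> bool,
  (forall x, (m < lev x <= n)%N -> c x = col x) ->
  forall f g : G -> G, automorphism f -> cancel f g -> cancel g f ->
    (lev (f v0) <= m)%N -> (lev (g v0) <= m)%N ->
    (exists2 x, (lev x <= m)%N & f x <> x) -> ~ preserves f c.
have /choice[N HN] (m : nat) : exists p : nat * (G -> bool),
    (m < p.1)%N /\ breaks m p.1 p.2.
  have [b Hb] := sparse_exponent m.*2.+1 eps_gt0.
  have [n] := large (maxn b m.*2.+1).
  rewrite geq_max => /andP[bn mn] /(Hb _ _ bn) small.
  have [col Hcol] := breaking_annulus levP G_locally_finite G_motion mn small.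
  by exists (n, col); split=> //=; lia.
have [c Hc] := glue_annuli lev (fun m => (N m).2) (fun m => (HN m).1).
apply: (@distinguishing_number_le2 G v0 c) => f faut [x fx] fc.
case: (faut) => -[g fK gK] _.
(* Each round ends strictly beyond its start, so round [b] starts at some [m >= b], large enough to
   catch [f]. *)
pose b := maxn (lev x) (maxn (lev (f v0)) (lev (g v0))).
pose m := iter b (fun m => (N m).1) 0%N.
have : (b <= m)%N.
  rewrite /m; elim: (b) => //= k IH; have [lt _] := HN (iter k (fun m => (N m).1) 0%N).
  lia.
rewrite !geq_max => /and3P[xm fm gm].
have [_ brk] := HN m.
by apply: (brk c (Hc b) f g faut fK gK fm gm _ fc); exists x.
Qed.
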